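(* The algebra ${\rm PFSym}$ is freely generated, as an associative unital algebra, by the set $\{M_a : a\in\mathcal{U}P\}$ of monomial basis elements indexed by unsplitable parking functions.
   Context: $\mathbb{K}$ is a field of characteristic zero. Words. Words are finite words on positive integers. $\epsilon$ is the empty word, $\cdot$ is concatenation, and $w+k$ adds $k$ to each letter of $w$. Parking functions. A word $a\in[n]^n$ is a parking function of length $n$ if its nondecreasing rearrangement $b_1\le\cdots\le b_n$ satisfies $b_i\le i$. $P_n$ is the set of these, $P_0=\{\epsilon\}$. LR-decomposition. Let $a=a_1\cdots a_n$ be nonempty. A position $i$ is a left-to-right minimum if $i=1$, or if $a_i<a_j$ for all $j<i$. Let $i_1<\cdots<i_s$ be these positions and $i_{s+1}=n+1$. Set $w_j=a_{i_{s+1-j}}\cdots a_{i_{s+2-j}-1}$. Then $F_a=(w_1,\ldots,w_s)$ (so $a=w_s\cdots w_1$, each $w_j$ begins with its minimum, and $\min w_1<\cdots<\min w_s$), identified with the set of its words. Any such sequence/set of words determines a unique word with that LR-decomposition, namely the concatenation of its words in decreasing order of minima. ${\rm PFSym}$. This is $\bigoplus_{n\ge0}\mathbb{K}\{M_a: a\in P_n\}$ with $M_\epsilon=1$ and the following product (it is a Hopf algebra with a coproduct not needed here). $M_a\star M_\epsilon=M_\epsilon\star M_a=M_a$. For $a\in P_m$ and $b\in P_n$ with $m,n\ge1$, sum over all matchings $\Theta$ (including the empty one) between the vertex sets $F_a$ and $F_b+m=\{w+m:w\in F_b\}$. For each $\Theta$, $a\Theta b$ is the parking function whose LR-decomposition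 is obtained from $F_a\cup(F_b+m)$ by replacing each edge $(u,w+m)$ by the word $u\cdot(w+m)$. Then $M_a\star M_b=\sum_\Theta M_{a\Theta b}$. Split product. Let $a\in P_m$ and $b\in P_n$ with $F_a=(u_1,\dots,u_r)$ and $F_b=(w_1,\dots,w_s)$. - If $r\le s$, put $F_a\circ F_b=(u_1\cdot(w_1+m),\dots,u_r\cdot(w_r+m),w_{r+1}+m,\dots,w_s+m)$. - If $r>s$, put $F_a\circ F_b=(u_1\cdot(w_1+m),\dots,u_s\cdot(w_s+m),u_{s+1},\dots,u_r)$. The split product $a\circ b$ is the parking function with $F_{a\circ b}=F_a\circ F_b$. A nonempty parking function is unsplitable if it is not the split product of two nonempty parking functions. $\mathcal{U}P$ is the set of unsplitable parking functions of positive length. *)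

(* Defs.v *)
From HB Require Import structures.
From mathcomp Require Import all_boot all_order all_algebra.
From mathcomp Require Import finmap monalg.

Set Implicit Arguments.
Unset Strict Implicit.
Unset Printing Implicit Defensive.

Import GRing.Theory.
Local Open Scope fset_scope.
Local Open Scope nat_scope.

Notation word := (seq nat).

Definition shift (k : nat) (w : word) : word := [seq (x + k)%N | x <- w].

Definition parking (a : word) : bool :=
  all (fun x => 0 < x <= size a)%N a &&
  all (fun i => nth 0%N (sort leq a) i <= i.+1)%N (iota 0 (size a)).

(* Parking functions of all lengths; the length of a : pfun is size a. *)
Record pfun : predArgType := PFun { pfword :> word; _ : parking pfword }.
HB.instance Definition _ := [isSub for pfword].
HB.instance Definition _ := [Choice of pfun by <:].

Definition pf_nil : pfun := @PFun [::] isT.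

(* lr a is the LR-decomposition (w_1, ..., w_s) of a, with a = w_s ... w_1.  The
   word is scanned from left to right, the current (last) block being the head
   of the list: a letter smaller than the first letter of the current block,
   i.e. than all the letters read so far, is a left-to-right minimum and opens a
   new block.  See lrP and lr_unique for the characterization by lrseq. *)
Definition lr_step (F : seq word) (x : nat) : seq word :=
  if F is w :: F' then
    if (x < head 0 w)%N then [:: x] :: F else rcons w x :: F'
  else [:: [:: x]].

Definition lr (a : word) : seq word := foldl lr_step [::] a.

(* A nonempty word whose first letter is its minimum. *)
Definition block (w : word) : bool := (w != [::]) && all (leq (head 0%N w)) w.


Definition lrseq (F : seq word) : bool :=
  all block F && sorted ltn [seq head 0%N w | w <- F].

Lemma lr_step_lrseq F x :
  lrseq F -> lrseq (lr_step F x) /\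
  flatten (rev (lr_step F x)) = rcons (flatten (rev F)) x.
Proof.
case: F => [|w F] /=; first by rewrite /lrseq /block /= leqnn.
rewrite /lrseq /= => /andP[/andP[bw bF] pF]; case: ifP => [lxw|nlxw].
  split; first by rewrite /= bF bw pF /block /= leqnn lxw.
  by rewrite rev_cons flatten_rcons /= cats1.
have hw : head 0%N (rcons w x) = head 0%N w by case: w bw {pF nlxw}.
split; first by rewrite /= /block hw all_rcons leqNgt nlxw bF pF /= andbT;
  case/andP: bw => _ ->; case: (w).
by rewrite !rev_cons !flatten_rcons rcons_cat.
Qed.

Lemma lr_rcons a x : lr (rcons a x) = lr_step (lr a) x.
Proof. by rewrite /lr foldl_rcons. Qed.

Lemma lrP a : lrseq (lr a) /\ flatten (rev (lr a)) = a.
Proof.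
elim/last_ind: a => [|a x [IH1 IH2]] //; rewrite lr_rcons.
by have [-> ->] := lr_step_lrseq x IH1; rewrite IH2.
Qed.

Lemma lr_unique F : lrseq F -> lr (flatten (rev F)) = F.
Proof.
elim: F => [|w F IH] //= /andP[/= /andP[bw bF] pF].
have sF : sorted ltn [seq head 0%N w | w <- F] by apply: path_sorted pF.
rewrite rev_cons flatten_rcons /lr foldl_cat -/(lr _) IH ?/lrseq ?bF //.
case: w bw pF => [|x w] //= /andP[_ /= /andP[_ xw]] pF.
have -> : lr_step F x = [:: x] :: F.
  by case: F pF {IH bF sF} => [|v F] //= /andP[-> _].
suff gen v : foldl lr_step ((x :: v) :: F) w = ((x :: v) ++ w) :: F by exact: gen.
elim: w v xw => [|y w IHw] v /=; first by rewrite cats0.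
by case/andP=> xy xw; rewrite ltnNge xy /= IHw //= cat_rcons.
Qed.

(* The concatenation of the words of X in decreasing order of minima; the minimum
   of a block is its first letter, hence the sort on head. *)
Definition assemble (X : seq word) : word :=
  flatten (rev (sort (relpre (head 0%N) leq) X)).

Lemma assemble_lr X : all block X -> uniq [seq head 0%N w | w <- X] ->
  lr (assemble X) = sort (relpre (head 0%N) leq) X.
Proof.
move=> bX uX; rewrite /assemble lr_unique // /lrseq all_sort bX /=.
by rewrite -sort_map ltn_sorted_uniq_leq sort_uniq uX sort_sorted //; apply: leq_total.
Qed.

Lemma perm_assemble X Y : uniq [seq head 0%N w | w <- X] -> perm_eq X Y ->
  assemble X = assemble Y.
Proof.
move=> uX pXY; rewrite /assemble; congr (flatten (rev _)); apply/perm_sort_inP => //.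
- by move=> u v _ _ /=; apply: leq_total.
- by move=> u v w _ _ _ /=; apply: leq_trans.
move=> u v uin vin /= /anti_leq huv.
elim: X uX uin vin {pXY} => [|w X IH] //= /andP[wX uX].
rewrite !inE => /orP[/eqP eu|uin] /orP[/eqP ev|vin]; last exact: IH.
- by rewrite eu ev.
- by case/negP: wX; rewrite -eu huv map_f.
by case/negP: wX; rewrite -ev -huv map_f.
Qed.

Lemma perm_flatten_assemble X : perm_eq (assemble X) (flatten X).
Proof.
rewrite /assemble; apply: perm_flatten; rewrite perm_rev; exact: permEl (perm_sort _ _).
Qed.

Lemma lr_assemble_sorted F : lrseq F -> assemble F = flatten (rev F).
Proof.
case/andP=> _ sF; rewrite /assemble sorted_sort //.
  by move=> u v w /=; apply: leq_trans.
rewrite -sorted_map; apply: sub_sorted sF => x y; exact: ltnW.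
Qed.

Lemma parking_perm a b : perm_eq a b -> parking a = parking b.
Proof.
move=> pab; rewrite /parking (perm_size pab) (perm_all _ pab).
by have /perm_sortP-> := pab => //; [apply: leq_total|apply: leq_trans|apply: anti_leq].
Qed.

Lemma parking_cat a b : parking a -> parking b -> parking (a ++ shift (size a) b).
Proof.
case/andP=> la pa /andP[lb pb]; apply/andP; split.
  rewrite all_cat all_map size_cat size_map; apply/andP; split.
    by apply: sub_all la => x /andP[-> /= h]; apply: leq_trans h (leq_addr _ _).
  by apply: sub_all lb => x /= /andP[x0 h]; rewrite addn_gt0 x0 addnC leq_add2l.
have -> : sort leq (a ++ shift (size a) b) = sort leq a ++ shift (size a) (sort leq b).
  apply: (sorted_eq leq_trans anti_leq); first exact/sort_sorted/leq_total.
    rewrite sorted_pairwise; last exact: leq_trans.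
    rewrite pairwise_cat -!sorted_pairwise; try exact: leq_trans.
    rewrite sort_sorted /=; last exact: leq_total.
    apply/andP; split.
      apply/allrelP => x z; rewrite mem_sort => xa /mapP[y _ ->].
      have /andP[_ h] := allP la _ xa; exact: leq_trans h (leq_addl _ _).
    rewrite sorted_map; apply: sub_sorted (sort_sorted leq_total b) => x y /=.
    by rewrite leq_add2r.
  rewrite (permPl (permEl (perm_sort _ _))) perm_sym perm_cat //.
    exact: permEl (perm_sort _ _).
  exact/perm_map/permEl/perm_sort.
rewrite size_cat size_map iotaD all_cat; apply/andP; split.
  apply/allP => i; rewrite mem_iota /= => ia; rewrite nth_cat size_sort ia.
  by apply: (allP pa); rewrite mem_iota.
apply/allP => i; rewrite mem_iota add0n => /andP[hi hi'].
rewrite nth_cat size_sort ltnNge hi /=.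
have ib : (i - size a < size b)%N by rewrite ltn_subLR.
rewrite (nth_map 0%N) ?size_sort // -[X in (_ <= X.+1)%N](subnK hi) -addSn leq_add2r.
by apply: (allP pb); rewrite mem_iota.
Qed.

(* The parking function whose LR-decomposition is the set of blocks X.  The
   default value pf_nil is never used: see lrset_theta and lr_split below. *)
Definition pf_of (X : seq word) : pfun := insubd pf_nil (assemble X).

Lemma pf_ofE (X : seq word) (a : word) :
  perm_eq (flatten X) a -> parking a -> pfword (pf_of X) = assemble X.
Proof.
move=> pXa pa; rewrite /pf_of val_insubd.
by rewrite (parking_perm (perm_trans (perm_flatten_assemble X) pXa)) pa.
Qed.

Lemma pf_of_lr (a : pfun) : pf_of (lr a) = a.
Proof.
have [h1 h2] := lrP a; apply: val_inj => /=.
rewrite (pf_ofE _ (valP a)) ?lr_assemble_sorted //.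
apply: (@perm_trans _ (flatten (rev (lr a)))); last by rewrite h2.
by apply: perm_flatten; rewrite perm_sym perm_rev.
Qed.

(* A matching is a set of edges (u, w) no two of which share an endpoint; the
   vertices are the words themselves. *)
Definition is_matching (T : {fset word * word}) : bool :=
  [forall e : T, forall e' : T,
     (((val e).1 == (val e').1) || ((val e).2 == (val e').2)) ==> (e == e')].

Definition matchings (U W : {fset word}) : {fset {fset word * word}} :=
  [fset T in fpowerset (U `*` W) | is_matching T].

(* U `|` W with the endpoints u, w of every edge replaced by the word u ++ w. *)
Definition join (T : {fset word * word}) (U W : {fset word}) : {fset word} :=
  [fset e.1 ++ e.2 | e in T] `|`
  ((U `\` [fset e.1 | e in T]) `|` (W `\` [fset e.2 | e in T])).

Lemma is_matchingP (T : {fset word * word}) :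
  reflect (forall e e', e \in T -> e' \in T ->
             (e.1 == e'.1) || (e.2 == e'.2) -> e = e') (is_matching T).
Proof.
apply: (iffP forallP) => [mT e e' eT e'T h|mT e].
  by have /forallP/(_ [` e'T])/implyP/(_ h)/eqP/(congr1 val) := mT [` eT].
apply/forallP => e'; apply/implyP => h; apply/eqP/val_inj.
exact: mT (fsvalP e) (fsvalP e') h.
Qed.

Lemma matchingsP (T : {fset word * word}) (U W : {fset word}) :
  reflect ((forall e, e \in T -> e.1 \in U /\ e.2 \in W) /\ is_matching T)
          (T \in matchings U W).
Proof.
rewrite !inE /= fpowersetE; apply: (iffP andP) => -[sT mT]; split=> //.
  by move=> e /(fsubsetP sT); rewrite !inE => /andP[].
by apply/fsubsetP => e /sT[eU eW]; rewrite !inE eU.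
Qed.

Lemma joinP (T : {fset word * word}) (U W : {fset word}) x :
  reflect [\/ exists2 e, e \in T & x = e.1 ++ e.2,
              x \in U /\ (forall e, e \in T -> e.1 <> x) |
              x \in W /\ (forall e, e \in T -> e.2 <> x)] (x \in join T U W).
Proof.
rewrite /join in_fsetU in_fsetU !in_fsetD; apply: (iffP or3P).
  case=> [/imfsetP[e /= eT ->]|/andP[/imfsetP h xU]|/andP[/imfsetP h xW]].
  - by constructor 1; exists e.
  - by constructor 2; split=> // e eT ex; apply: h; exists e.
  - by constructor 3; split=> // e eT ex; apply: h; exists e.
case=> [[e eT ->]|[xU h]|[xW h]].
- by constructor 1; apply/imfsetP; exists e.
- by constructor 2; rewrite xU andbT; apply/imfsetP => -[e eT ex]; exact: h eT (esym ex).
- by constructor 3; rewrite xW andbT; apply/imfsetP => -[e eT ex]; exact: h eT (esym ex).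
Qed.

Lemma matchingsS u (U W : {fset word}) T :
  T \in matchings U W -> T \in matchings (u |` U) W.
Proof.
case/matchingsP=> sT mT; apply/matchingsP; split=> // e /sT[eU eW].
by rewrite !inE eU orbT.
Qed.

Lemma matchingsE u w (U W : {fset word}) T : u \notin U -> w \in W ->
  T \in matchings U (W `\ w) -> (u, w) |` T \in matchings (u |` U) W.
Proof.
move=> uU wW /matchingsP[sT /is_matchingP mT].
have sT1 e : e \in T -> (e.1 == u) = false /\ (e.2 == w) = false.
  move=> /sT; rewrite !inE => -[eU /andP[/negbTE-> _]]; split=> //.
  by apply: contraNF uU => /eqP<-.
apply/matchingsP; split.
  move=> e; rewrite !inE => /orP[/eqP->|/sT]; first by rewrite eqxx.
  by rewrite !inE => -[-> /andP[_ ->]]; rewrite orbT.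
apply/is_matchingP => e e'; rewrite !inE => /orP[/eqP->|eT] /orP[/eqP->|e'T] //=.
- by rewrite ![_ == _.1]eq_sym ![_ == _.2]eq_sym; have [-> ->] := sT1 _ e'T.
- by have [-> ->] := sT1 _ eT.
exact: mT.
Qed.

Lemma matchings_inv u (U W : {fset word}) T : u \notin U ->
  T \in matchings (u |` U) W ->
  T \in matchings U W \/
  exists2 w, w \in W & exists2 T', T' \in matchings U (W `\ w) & T = (u, w) |` T'.
Proof.
move=> uU /matchingsP[sT mT].
have [/hasP[[u' w] eT /= /eqP u'u]|/hasPn nT] := boolP (has (fun e => e.1 == u) T).
  subst u'; right; exists w; first by have [] := sT _ eT.
  exists (T `\ (u, w)); last by rewrite fsetD1K.
  move/is_matchingP: mT => mT.
  apply/matchingsP; split; last first.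
    apply/is_matchingP => e e'; rewrite !inE => /andP[_ h] /andP[_ h']; exact: mT.
  move=> e; rewrite !inE => /andP[ne eT']; have [] := sT _ eT'.
  rewrite !inE => /orP[/eqP eu|-> ->].
    by case/eqP: ne; apply: mT => //=; rewrite eu eqxx.
  split=> //; rewrite andbT; apply: contraNneq ne => ew.
  by apply/eqP; apply: mT => //=; rewrite ew eqxx orbT.
left; apply/matchingsP; split=> // e eT; have [] := sT _ eT.
by rewrite !inE (negbTE (nT _ eT)).
Qed.

Lemma big_matchings (V : nmodType) u (U W : {fset word})
    (G : {fset word * word} -> V) : u \notin U ->
  (\sum_(T <- matchings (u |` U) W) G T = \sum_(T <- matchings U W) G T +
     \sum_(w <- W) \sum_(T <- matchings U (W `\ w)) G ((u, w) |` T))%R.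
Proof.
move=> uU; rewrite -big_allpairs_dep -big_cat; apply: perm_big; apply: uniq_perm.
- exact: fset_uniq.
- rewrite cat_uniq fset_uniq /=; apply/andP; split.
    apply/hasPn => T /allpairsPdep[w [T' [wW T'M ->]]].
    apply/negP => /matchingsP[/(_ (u, w))]; rewrite !inE eqxx => /(_ isT)[/= h].
    by rewrite h in uU.
  apply: allpairs_uniq_dep => [|w _|[w1 T1] [w2 T2]]; try exact: fset_uniq.
  move=> /allpairsPdep[w1' [T1' [w1W T1M /= e1]]].
  move=> /allpairsPdep[w2' [T2' [w2W T2M /= e2]]] /= e12.
  have {e1}[? e1] : w1 = w1' /\ T1 = T1' by case: e1 => ? e1; subst w1'; split.
  have {e2}[? e2] : w2 = w2' /\ T2 = T2' by case: e2 => ? e2; subst w2'; split.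
  subst.
  have nin w T : T \in matchings U (W `\ w) -> forall w', (u, w') \notin T.
    move=> /matchingsP[sT _] w'; apply/negP => /sT[h _].
    by rewrite h in uU.
  have : (u, w1') \in (u, w2') |` T2' by rewrite -e12 !inE eqxx.
  rewrite !inE (negbTE (nin _ _ T2M _)) orbF => /eqP[?]; subst w2'.
  congr (Tagged _ _).
  have := congr1 (fun X => X `\ (u, w1')) e12.
  by rewrite /= (fsetU1K (nin _ _ T1M _)) (fsetU1K (nin _ _ T2M _)).
move=> T; rewrite mem_cat; apply/idP/orP.
  case/(matchings_inv uU) => [->|[w wW [T' T'M ->]]]; first by left.
  by right; apply/allpairsPdep; exists w, T'.
case=> [|/allpairsPdep[w [T' [wW T'M ->]]]]; first exact: matchingsS.
exact: matchingsE.
Qed.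

Lemma joinU u (U W : {fset word}) T : u \notin U -> T \in matchings U W ->
  join T (u |` U) W = u |` join T U W.
Proof.
move=> uU /matchingsP[sT _]; apply/fsetP => x; rewrite [RHS]in_fset1U.
apply/joinP/orP.
  case=> [h|[/fset1UP[->|xU] h]|h].
  - by right; apply/joinP; constructor 1.
  - by left.
  - by right; apply/joinP; constructor 2.
  - by right; apply/joinP; constructor 3.
case=> [/eqP->|/joinP[h|[xU h]|h]].
- constructor 2; split=> [|e /sT[eU _] eu]; first exact: fset1U1.
  by rewrite -eu eU in uU.
- by constructor 1.
- by constructor 2; split=> //; apply/fset1UP; right.
- by constructor 3.
Qed.

Lemma joinE u w (U W : {fset word}) T : u \notin U -> w \in W ->
  T \in matchings U (W `\ w) ->
  join ((u, w) |` T) (u |` U) W = (u ++ w) |` join T U (W `\ w).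
Proof.
move=> uU wW /matchingsP[sT _]; apply/fsetP => x; rewrite [RHS]in_fset1U.
apply/joinP/orP.
  case=> [[e /fset1UP[->->|eT ->]]|[/fset1UP[->|xU] h]|[xW h]].
  - by left.
  - by right; apply/joinP; constructor 1; exists e.
  - by case: (h _ (fset1U1 _ _)).
  - right; apply/joinP; constructor 2; split=> // e eT; apply: h.
    by apply/fset1UP; right.
  - right; apply/joinP; constructor 3; split.
      apply/fsetD1P; split=> //; apply/eqP => xw.
      by apply: (h (u, w)); [exact: fset1U1 | rewrite xw].
    by move=> e eT; apply: h; apply/fset1UP; right.
case=> [/eqP->|/joinP[[e eT ->]|[xU h]|[/fsetD1P[/eqP xw xW] h]]].
- by constructor 1; exists (u, w) => //; exact: fset1U1.
- by constructor 1; exists e => //; apply/fset1UP; right.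
- constructor 2; split=> [|e /fset1UP[->|/h//] /= ux]; first by apply/fset1UP; right.
  by rewrite ux xU in uU.
by constructor 3; split=> // e /fset1UP[->|/h//] /= wx; apply: xw.
Qed.

(* sel and merges enumerate the outcomes of all matchings recursively; they are
   only used to prove that the product below is associative. *)
Section Merges.
Variable A : Type.

Fixpoint sel (W : seq A) : seq (A * seq A) :=
  if W is w :: W' then (w, W') :: [seq (p.1, w :: p.2) | p <- sel W'] else [::].
End Merges.

Fixpoint merges (U W : seq word) : seq (seq word) :=
  if U is u :: U' then
    [seq u :: X | X <- merges U' W] ++
    [seq (u ++ p.1) :: X | p <- sel W, X <- merges U' p.2]
  else [:: W].

Lemma big_merges (V : nmodType) u U W (f : seq word -> V) :
  (\sum_(X <- merges (u :: U) W) f X = \sum_(X <- merges U W) f (u :: X) +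
    \sum_(p <- sel W) \sum_(X <- merges U p.2) f ((u ++ p.1) :: X))%R.
Proof. by rewrite /= big_cat big_map big_allpairs_dep. Qed.

Lemma big_sel (A : Type) (V : nmodType) (w : A) W (F : A * seq A -> V) :
  (\sum_(p <- sel (w :: W)) F p =
   F (w, W) + \sum_(p <- sel W) F (p.1, w :: p.2))%R.
Proof. by rewrite /= big_cons big_map. Qed.

Lemma sel_fset (V : nmodType) (W : seq word) (h : word -> {fset word} -> V) : uniq W ->
  (\sum_(w <- W) h w ([fset x in W] `\ w) =
   \sum_(p <- sel W) h p.1 [fset x in p.2])%R.
Proof.
elim: W h => [|w W IH] h; first by rewrite !big_nil.
case/andP=> wW uW; rewrite big_sel big_cons /=.
have setE : [fset x in w :: W] = w |` [fset x in W].
  by apply/fsetP => x; rewrite !inE.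
congr (_ + _)%R; first by rewrite setE fsetU1K // !inE.
have -> : (\sum_(p <- sel W) h p.1 [fset x in w :: p.2] =
  \sum_(p <- sel W) h p.1 (w |` [fset x in p.2]))%R.
  apply: eq_bigr => p _; congr (h _ _); by apply/fsetP => x; rewrite !inE.
rewrite -(IH (fun v X => h v (w |` X))) // !big_seq; apply: eq_bigr => v vW.
congr (h _ _); rewrite setE; apply/fsetP => x; rewrite !inE.
by case: eqP => [->|] //=; case: eqP => // wx; rewrite -wx vW in wW.
Qed.

Lemma sel_perm (A : eqType) (W : seq A) p : p \in sel W -> perm_eq W (p.1 :: p.2).
Proof.
elim: W p => [|w W IH] p //=; rewrite inE => /orP[/eqP->//|/mapP[q /IH h ->] /=].
apply: (@perm_trans _ (w :: q.1 :: q.2)); first by rewrite perm_cons.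
by rewrite (perm_catCA [:: w] [:: q.1] q.2).
Qed.

Lemma sum_matchings (V : nmodType) (U W : seq word) (g : {fset word} -> V) :
  uniq U -> uniq W ->
  (\sum_(T <- matchings [fset x in U] [fset x in W])
      g (join T [fset x in U] [fset x in W]) =
   \sum_(X <- merges U W) g [fset x in X])%R.
Proof.
have consE u (X : seq word) : [fset x in u :: X] = u |` [fset x in X].
  by apply/fsetP => x; rewrite !inE.
elim: U W g => [|u U IH] W g /=.
  move=> _ _; rewrite big_seq1.
  have -> : matchings [fset x in [::]] [fset x in W] = [fset fset0].
    apply/fsetP => T; rewrite in_fset1; apply/matchingsP/eqP.
      by move=> [sT _]; apply/fsetP => e; rewrite inE; apply/negP => /sT[]; rewrite !inE.
    by move=> ->; split=> //; apply/is_matchingP.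
  rewrite big_seq_fset1; congr g; apply/fsetP => x; apply/joinP/idP.
    by case=> [[]|[]|[]] //; rewrite !inE.
  by constructor 3.
case/andP=> uU uqU uqW; have uU' : u \notin [fset x in U] by rewrite !inE.
rewrite consE big_matchings // -/(merges (u :: U) W) big_merges; congr (_ + _)%R.
  have := IH W (fun Y => g (u |` Y)) uqU uqW.
  under [RHS]eq_bigr => X _ do rewrite -consE.
  move=> <-; rewrite !big_seq; apply: eq_bigr => T TM; by rewrite joinU.
transitivity (\sum_(w <- W) \sum_(T <- matchings [fset x in U] ([fset x in W] `\ w))
      g ((u ++ w) |` (join T [fset x in U] ([fset x in W] `\ w))))%R.
  rewrite (perm_big W) /=; last first.
    by apply: uniq_perm => [||x]; rewrite ?fset_uniq // !inE.
  rewrite !big_seq; apply: eq_bigr => w wW.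
  by rewrite !big_seq; apply: eq_bigr => T TM; rewrite joinE // !inE.
rewrite (sel_fset (fun w X => \sum_(T <- matchings [fset x in U] X)
   g ((u ++ w) |` (join T [fset x in U] X)))%R) // !big_seq.
apply: eq_bigr => p /sel_perm/perm_uniq; rewrite uqW /= => /esym/andP[_ up].
rewrite (IH _ (fun Y => g ((u ++ p.1) |` Y))) //.
by apply: eq_bigr => X _; rewrite consE.
Qed.

Lemma sel2C (A : Type) (V : nmodType) (W : seq A) (f : A -> A -> seq A -> V) :
  (\sum_(p <- sel W) \sum_(q <- sel p.2) f p.1 q.1 q.2 =
   \sum_(p <- sel W) \sum_(q <- sel p.2) f q.1 p.1 q.2)%R.
Proof.
elim: W f => [|w W IH] f; first by rewrite !big_nil.
rewrite !big_sel /=; under [X in (_ + X = _)%R]eq_bigr => p _ do rewrite big_sel.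
under [X in (_ = _ + X)%R]eq_bigr => p _ do rewrite big_sel.
by rewrite !big_split /= (IH (fun x y X => f x y (w :: X))) addrCA.
Qed.

Lemma sel_merges (V : nmodType) (U W : seq word) (F : word * seq word -> V) :
  (\sum_(X <- merges U W) \sum_(q <- sel X) F q =
   \sum_(p <- sel U) \sum_(X <- merges p.2 W) F (p.1, X) +
   (\sum_(r <- sel W) \sum_(X <- merges U r.2) F (r.1, X) +
    \sum_(p <- sel U) \sum_(r <- sel W) \sum_(X <- merges p.2 r.2)
      F (p.1 ++ r.1, X)))%R.
Proof.
elim: U W F => [|u U IH] W F.
  rewrite /= !big_nil big_seq1 add0r addr0; apply: eq_bigr => -[x X] _.
  by rewrite big_seq1.
rewrite big_merges !big_sel /=.
under eq_bigr => X _ do rewrite big_sel.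
under [X in (_ + X = _)%R]eq_bigr => p _ do
  (under eq_bigr => X _ do rewrite big_sel; rewrite big_split /=).
rewrite !big_split /= (IH W (fun q => F (q.1, u :: q.2))) /=.
under [X in (_ + (_ + X) = _)%R]eq_bigr => p _ do
  rewrite (IH p.2 (fun q => F (q.1, (u ++ p.1) :: q.2))) /=.
rewrite !big_split /=.
under [X in (_ = _ + X + _)%R]eq_bigr => p _ do rewrite big_merges.
under [X in (_ = _ + (X + _))%R]eq_bigr => p _ do rewrite big_merges.
under [X in (_ = _ + (_ + (_ + X)))%R]eq_bigr => p _ do
  (under eq_bigr => r _ do rewrite big_merges; rewrite big_split /=).
rewrite !big_split /= -!addrA; congr (_ + _)%R.
rewrite (sel2C W (fun x y Y => \sum_(X <- merges U Y) F (y, (u ++ x) :: X)))%R /=.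
have AC (a2 a4 a5 a6 a7 : V) :
    (a6 + (a5 + (a2 + (a4 + a7))) = a2 + (a4 + (a5 + (a6 + a7))))%R.
  rewrite (addrCA a5 a2) (addrCA a6 a2) (addrCA a5 a4) (addrCA a6 a4).
  by rewrite (addrCA a6 a5).
congr (_ + _)%R; rewrite [RHS]addrCA; congr (_ + _)%R; rewrite AC.
congr (_ + _)%R; first exact: exchange_big.
do 3 congr (_ + _)%R; rewrite exchange_big /=; apply: eq_bigr => p _.
exact: (sel2C W (fun x y Y => \sum_(X <- merges p.2 Y)
  F (p.1 ++ y, (u ++ x) :: X)))%R.
Qed.

Lemma merges_assoc (V : nmodType) (U W Z : seq word) (f : seq word -> V) :
  (\sum_(X <- merges U W) \sum_(Y <- merges X Z) f Y =
   \sum_(X <- merges W Z) \sum_(Y <- merges U X) f Y)%R.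
Proof.
elim: U W Z f => [|u U IH] W Z f.
  rewrite /= big_seq1; apply: eq_bigr => X _; by rewrite big_seq1.
rewrite big_merges.
under [in X in (X + _ = _)%R]eq_bigr => X _ do rewrite big_merges.
under [X in (_ + X = _)%R]eq_bigr => p _ do
  (under eq_bigr => X _ do rewrite big_merges; rewrite big_split /=).
rewrite !big_split /=.
under [RHS]eq_bigr => X _ do rewrite big_merges.
rewrite big_split /=.
rewrite (sel_merges _ _ (fun q => \sum_(Y <- merges U q.2) f ((u ++ q.1) :: Y)))%R /=.
rewrite IH -!addrA; congr (_ + _)%R; rewrite addrCA; congr (_ + (_ + _))%R.
- by apply: eq_bigr => p _; rewrite IH.
- by rewrite exchange_big; apply: eq_bigr => r _; rewrite IH.
apply: eq_bigr => p _; rewrite exchange_big; apply: eq_bigr => r _.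
by rewrite /= IH catA.
Qed.

Lemma sel_map (A B : Type) (h : A -> B) (W : seq A) :
  sel (map h W) = [seq (h p.1, map h p.2) | p <- sel W].
Proof. by elim: W => //= w W ->; rewrite -!map_comp. Qed.

Lemma merges_map (h : word -> word) (U W : seq word) :
  (forall u w, h (u ++ w) = h u ++ h w) ->
  merges (map h U) (map h W) = [seq map h X | X <- merges U W].
Proof.
move=> hM; elim: U W => [|u U IH] W //=; rewrite map_cat IH -!map_comp; congr cat.
rewrite sel_map map_flatten -!map_comp; congr flatten; apply: eq_map => p /=.
by rewrite IH -!map_comp; apply: eq_map => X /=; rewrite hM.
Qed.

Lemma merges_nil (U : seq word) : merges U [::] = [:: U].
Proof. by elim: U => //= u U ->. Qed.

Lemma mergesP (P : seq word -> seq word -> seq word -> Prop) :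
  (forall W, P [::] W W) ->
  (forall u U W X, P U W X -> P (u :: U) W (u :: X)) ->
  (forall u w U W W' X, perm_eq W (w :: W') -> P U W' X ->
     P (u :: U) W ((u ++ w) :: X)) ->
  forall U W X, X \in merges U W -> P U W X.
Proof.
move=> P0 P1 P2; elim=> [|u U IH] W X /=; first by rewrite inE => /eqP->.
rewrite mem_cat => /orP[/mapP[Y /IH h ->]|]; first exact: P1.
by case/allpairsPdep=> p [Y [/sel_perm h /IH h' ->]]; apply: P2 h h'.
Qed.

Lemma merges_flatten U W X : X \in merges U W ->
  perm_eq (flatten X) (flatten U ++ flatten W).
Proof.
move: U W X; apply: mergesP => [W|u U W X /= h|u w U W W' X /= h1 h2] //=.
  by rewrite -catA perm_cat2l.
rewrite -!catA perm_cat2l; have := perm_cat (perm_refl w) h2; move/perm_trans; apply.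
rewrite perm_catCA perm_cat2l; have := perm_flatten h1; by rewrite perm_sym.
Qed.

Lemma merges_all (p q r : pred word) U W X : X \in merges U W ->
  (forall u, p u -> r u) -> (forall w, q w -> r w) ->
  (forall u w, p u -> q w -> r (u ++ w)) ->
  all p U -> all q W -> all r X.
Proof.
move=> XM pr qr pqr; move: U W X XM.
apply: mergesP => [W _|u U W X h /=|u w U W W' X h1 h2 /=]; first exact: sub_all.
  by case/andP=> /pr -> pU qW; rewrite h.
case/andP=> pu pU; rewrite (perm_all _ h1) /= => /andP[qw qW].
by rewrite pqr // h2.
Qed.

Definition heads (X : seq word) : seq nat := [seq head 0%N w | w <- X].

Lemma merges_heads U W X : X \in merges U W -> all block U ->
  uniq (heads U ++ heads W) -> uniq (heads X).
Proof.
move=> XM bU uUW.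
suff [D pD] : exists D, perm_eq (heads U ++ heads W) (heads X ++ D).
  by move: uUW; rewrite (perm_uniq pD) cat_uniq => /andP[].
move: bU {uUW}; move: U W X XM.
apply: mergesP => [W _|u U W X h /= /andP[_ /h[D pD]]|u w U W W' X h1 h2 /=].
- by exists [::]; rewrite cats0.
- by exists D; rewrite /= perm_cons.
case/andP=> /andP[nu _] /h2[D pD]; exists (head 0%N w :: D).
have -> : head 0%N (u ++ w) = head 0%N u by case: u nu.
rewrite /= perm_cons; apply: (@perm_trans _ (heads U ++ heads (w :: W'))).
  by rewrite perm_cat2l; apply: perm_map.
rewrite /= (perm_catCA (heads U) [:: head 0%N w]) perm_sym.
rewrite (perm_catCA (heads X) [:: head 0%N w]) /= perm_cons perm_sym //.
Qed.

Definition lrset (a : word) : {fset word} := [fset w in lr a].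

(* The parking function a T b, for a matching T between F_a and F_b + size a. *)
Definition theta (a b : pfun) (T : {fset word * word}) : pfun :=
  pf_of (join T (lrset a) [fset shift (size a) w | w in lrset b]).

Fixpoint split_words (k : nat) (U W : seq word) : seq word :=
  match U, W with
  | u :: U', w :: W' => (u ++ shift k w) :: split_words k U' W'
  | [::], _ => [seq shift k w | w <- W]
  | _, [::] => U
  end.

Definition split (a b : pfun) : pfun :=
  pf_of (split_words (size a) (lr a) (lr b)).

Definition unsplitable (a : pfun) : Prop :=
  a <> pf_nil /\
  ~ (exists b c : pfun, [/\ b <> pf_nil, c <> pf_nil & a = split b c]).

Definition low (k : nat) (w : word) : bool := block w && all (geq k) w.
Definition high (k : nat) (w : word) : bool := block w && all (ltn k) w.

Lemma heads_lr a : uniq (heads (lr a)).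
Proof.
have [/andP[_ h] _] := lrP a; apply: sorted_uniq h; [exact: ltn_trans|exact: ltnn].
Qed.

Lemma perm_lr a : perm_eq (flatten (lr a)) a.
Proof.
apply: (@perm_trans _ (flatten (rev (lr a)))); last by have [_ ->] := lrP a.
by apply: perm_flatten; rewrite perm_sym perm_rev.
Qed.

Lemma low_lr (a : pfun) : all (low (size a)) (lr a).
Proof.
have [/andP[/allP ba _] _] := lrP a; apply/allP => w wa; rewrite /low ba //=.
apply/allP => x xw; case/andP: (valP a) => /allP/(_ x) h _.
have /h/andP[_ //] : x \in val a.
by rewrite -(perm_mem (perm_lr a)); apply/flattenP; exists w.
Qed.

Lemma high_lr (k : nat) (b : pfun) : all (high k) (map (shift k) (lr b)).
Proof.
have [/andP[/allP bb _] _] := lrP b; apply/allP => _ /mapP[w wb ->].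
have /andP[nw lw] := bb _ wb; rewrite /high /block.
have -> : head 0 (shift k w) = head 0 w + k by case: w nw {wb lw}.
rewrite !all_map -andbA; apply/and3P; split; first by case: w nw {wb lw}.
  by apply: sub_all lw => x /=; rewrite leq_add2r.
apply/allP => x xw /=; rewrite -[X in X < _]add0n ltn_add2r.
case/andP: (valP b) => /allP/(_ x) h _.
have /h/andP[-> //] : x \in val b.
by rewrite -(perm_mem (perm_lr b)); apply/flattenP; exists w.
Qed.

Lemma uniq_heads_low_high k U W : all (low k) U -> all (high k) W ->
  uniq (heads U) -> uniq (heads W) -> uniq (heads U ++ heads W).
Proof.
move=> lU hW uU uW; rewrite cat_uniq uU uW andbT; apply/hasPn => _ /mapP[w wW ->].
have /andP[/andP[nw _] /allP hw] := allP hW _ wW.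
apply/negP => /mapP[u uinU e].
have /andP[/andP[nu _] /allP lu] := allP lU _ uinU.
have hin (v : word) : v != [::] -> head 0 v \in v.
  by case: v => // x v _; rewrite inE eqxx.
have := hw _ (hin _ nw); rewrite e /= => /(leq_ltn_trans (lu _ (hin _ nu))).
by rewrite ltnn.
Qed.

Lemma block_low_high k u w : low k u -> high k w -> block (u ++ w).
Proof.
case/andP=> /andP[nu bu] lu /andP[_ hw]; rewrite /block.
case: u nu bu lu => //= x u _ /andP[_ xu] /andP[xk _]; rewrite leqnn all_cat xu /=.
by apply: sub_all hw => y /ltnW; apply: leq_trans xk.
Qed.

Lemma heads_shift k W : all block W ->
  heads (map (shift k) W) = [seq (x + k) | x <- heads W].
Proof.
elim: W => [|w W IH] //= /andP[/andP[nw _] bW]; rewrite IH //; congr cons.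
by case: w nw.
Qed.

Lemma uniq_heads_shift k b : uniq (heads (map (shift k) (lr b))).
Proof.
have [/andP[bb _] _] := lrP b; rewrite heads_shift // map_inj_uniq ?heads_lr //.
exact: addIn.
Qed.

Lemma heads_uniq X : uniq (heads X) -> uniq X.
Proof. exact: map_uniq. Qed.

Definition pf_fset (X : seq word) : pfun := pf_of [fset x in X].

Lemma perm_fset (X : seq word) : uniq X -> perm_eq [fset x in X] X.
Proof. by move=> uX; apply: uniq_perm => [||x]; rewrite ?fset_uniq // !inE. Qed.

Lemma lrset_pf_fset (X : seq word) (a : word) : all block X -> uniq (heads X) ->
  perm_eq (flatten X) a -> parking a ->
  lrset (pf_fset X) = [fset x in X] /\ size (pf_fset X) = size a.
Proof.
move=> bX uX pXa pa; have pX := perm_fset (heads_uniq uX).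
have uX' : uniq (heads [fset x in X]).
  by rewrite (perm_uniq (perm_map _ pX)).
have fX := perm_trans (perm_flatten pX) pXa.
rewrite /pf_fset /lrset (pf_ofE fX pa) assemble_lr //; last by rewrite (perm_all _ pX).
split; first by apply/fsetP => x; rewrite !inE mem_sort !inE.
by rewrite (perm_size (perm_flatten_assemble _)) (perm_size fX).
Qed.

Lemma pf_fset_lr (a : pfun) : pf_fset (lr a) = a.
Proof.
rewrite -[RHS]pf_of_lr /pf_fset /pf_of; congr insubd.
have p := perm_fset (heads_uniq (heads_lr a)).
by apply: perm_assemble => //; rewrite (perm_uniq (perm_map _ p)) heads_lr.
Qed.

Lemma merges_lr (a b : pfun) X :
  X \in merges (lr a) (map (shift (size a)) (lr b)) ->
  [/\ all block X, uniq (heads X), lrset (pf_fset X) = [fset x in X] &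
      size (pf_fset X) = size a + size b].
Proof.
move=> XM; have la := low_lr a; have hb := high_lr (size a) b.
have ba : all block (lr a) by apply: sub_all la => w /andP[].
have bX : all block X.
  apply: merges_all XM _ _ _ la hb => [w /andP[]|w /andP[]|u w] //.
  exact: block_low_high.
have uX : uniq (heads X).
  apply: merges_heads XM ba _; apply: uniq_heads_low_high la hb _ _.
    exact: heads_lr.
  exact: uniq_heads_shift.
have pX : perm_eq (flatten X) (a ++ shift (size a) b).
  apply: perm_trans (merges_flatten XM) _; apply: perm_cat (perm_lr a) _.
  by rewrite -map_flatten; apply/perm_map/perm_lr.
have pp := parking_cat (valP a) (valP b).
have [? ->] := lrset_pf_fset bX uX pX pp.
by split=> //; rewrite size_cat size_map.
Qed.

Lemma shift_fset k (W : seq word) :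
  [fset shift k w | w in [fset x in W]] = [fset x in map (shift k) W].
Proof.
apply/fsetP => x; apply/imfsetP/idP => [[w]|].
  by rewrite !inE /= => wW ->; apply: map_f.
by rewrite !inE => /mapP[w wW ->]; exists w; rewrite //= !inE.
Qed.

Lemma join_merges (U W : seq word) T : uniq U -> uniq W ->
  T \in matchings [fset x in U] [fset x in W] ->
  exists2 X, X \in merges U W & join T [fset x in U] [fset x in W] = [fset x in X].
Proof.
move=> uU uW TM; set J := join T _ _.
have [/hasP[X XM /eqP]|/hasPn nX] :=
  boolP (has (fun X => J == [fset x in X]) (merges U W)); first by exists X.
have /eqP := sum_matchings (fun Y => nat_of_bool (J == Y)) uU uW.
rewrite [X in _ == X]big_seq [X in _ == X]big1 => [|X XM]; last first.
  by rewrite (negbTE (nX _ XM)).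
rewrite (big_rem T) //= eqxx.
by rewrite -[(_ + _)%R]/(_ + _)%N.
Qed.

Lemma lrset_theta (a b : pfun) T :
  T \in matchings (lrset a) [fset shift (size a) w | w in lrset b] ->
  lrset (theta a b T) = join T (lrset a) [fset shift (size a) w | w in lrset b].
Proof.
rewrite /theta {1 2 3 4}/lrset !shift_fset => TM.
have [X XM ->] := join_merges (heads_uniq (heads_lr a))
  (heads_uniq (uniq_heads_shift (size a) b)) TM.
by have [_ _ e _] := merges_lr XM; exact: e.
Qed.

Lemma mem_merges u U W p X : p \in sel W -> X \in merges U p.2 ->
  (u ++ p.1) :: X \in merges (u :: U) W.
Proof.
move=> pW XM; rewrite /= mem_cat; apply/orP; right.
by apply/allpairsPdep; exists p, X.
Qed.

Lemma split_words_merges k (U W : seq word) :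
  split_words k U W \in merges U (map (shift k) W).
Proof.
elim: U W => [|u U IH] [|w W].
- exact: mem_head.
- exact: mem_head.
- by rewrite [map _ _]/= merges_nil mem_head.
apply: (@mem_merges u U _ (shift k w, map (shift k) W)); last exact: IH.
by rewrite /= inE eqxx.
Qed.

Lemma split_words_sorted k (U W : seq word) : all (low k) U -> all (high k) (map (shift k) W) ->
  sorted ltn (heads U) -> sorted ltn (heads (map (shift k) W)) ->
  sorted ltn (heads (split_words k U W)).
Proof.
elim: U W => [|u U IH] [|w W] //= /andP[lu lU] /andP[hw hW] pU pW.
have nu : head 0 (u ++ shift k w) = head 0 u.
  by case/andP: lu => /andP[+ _] _; case: u {pU}.
have := IH W lU hW (path_sorted pU) (path_sorted pW); rewrite nu.
case: U W pU {IH} lU hW {pW} => [|u' U] [|w' W] //=.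
- move=> _ _ /andP[/andP[/andP[+ _] hw'] _] ->; rewrite andbT => nw'.
  case/andP: lu => /andP[nu' _] lu.
  have /allP/(_ (head 0 u)) := lu; have /allP/(_ (head 0 (shift k w'))) := hw'.
  have hin (v : word) : v != [::] -> head 0 v \in v.
    by case: v => // x v _; rewrite inE eqxx.
  by move=> /(_ (hin _ nw')) /= h /(_ (hin _ nu')) /= /leq_ltn_trans; apply.
move=> /andP[h _] /andP[lu' _] _ ->; rewrite andbT.
by case/andP: lu' => /andP[+ _] _; case: (u') h.
Qed.

Lemma lr_split (a b : pfun) : lr (split a b) = split_words (size a) (lr a) (lr b).
Proof.
set X := split_words _ _ _.
have XM : X \in merges (lr a) (map (shift (size a)) (lr b)).
  exact: split_words_merges.
have [bX uX _ _] := merges_lr XM.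
have [/andP[_ sa] _] := lrP a; have [/andP[bb sb] _] := lrP b.
have sX : lrseq X.
  rewrite /lrseq bX; apply: split_words_sorted => //; first exact: low_lr.
    exact: high_lr.
  by rewrite heads_shift // sorted_map; apply: sub_sorted sb => x y /=; rewrite ltn_add2r.
have pX : perm_eq (flatten X) (a ++ shift (size a) b).
  apply: perm_trans (merges_flatten XM) _; apply: perm_cat (perm_lr a) _.
  by rewrite -map_flatten; apply/perm_map/perm_lr.
rewrite /split (pf_ofE pX (parking_cat (valP a) (valP b))).
by rewrite lr_assemble_sorted // lr_unique.
Qed.

Local Open Scope ring_scope.

Definition PFSym (K : fieldType) : Type := {malg K[pfun]}.
HB.instance Definition _ (K : fieldType) := GRing.Lmodule.on (PFSym K).

Definition M (K : fieldType) (a : pfun) : PFSym K := << a >>.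

(* The product of two basis elements; see mul_PFSym. *)
Definition mulM (K : fieldType) (a b : pfun) : PFSym K :=
  \sum_(T <- matchings (lrset a) [fset shift (size a) w | w in lrset b])
     M K (theta a b T).

(* The linear extension of h : pfun -> V along the basis (M a). *)
Definition linext (K : fieldType) (V : lmodType K) (h : pfun -> V) (x : PFSym K) : V :=
  \sum_(a <- msupp x) x@_a *: h a.

Definition pfmul (K : fieldType) (x y : PFSym K) : PFSym K :=
  linext (fun a => linext (fun b => mulM K a b) y) x.

Section LinearExtension.
Variables (K : fieldType) (V : lmodType K).
Implicit Types (h : pfun -> V) (x y : PFSym K).

Lemma linextEw h x (d : {fset pfun}) : msupp x `<=` d ->
  linext h x = \sum_(a <- d) x@_a *: h a.
Proof.
move=> sd; rewrite /linext (big_fset_incl _ sd) // => a ad /mcoeff_outdom ->.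
by rewrite scale0r.
Qed.

Lemma linext_is_linear h : linear (linext h).
Proof.
move=> k x y; pose d := msupp (k *: x + y) `|` (msupp x `|` msupp y).
have sxy : msupp (k *: x + y) `<=` d by rewrite fsubsetUl.
have sx : msupp x `<=` d by rewrite /d fsetUCA fsubsetUl.
have sy : msupp y `<=` d by rewrite /d fsetUA fsubsetUr.
rewrite (linextEw h sxy) (linextEw h sx) (linextEw h sy).
rewrite scaler_sumr -big_split /=; apply: eq_bigr => a _.
by rewrite mcoeffD mcoeffZ scalerDl scalerA.
Qed.
HB.instance Definition _ h :=
  GRing.isLinear.Build K (PFSym K) V _ (linext h) (linext_is_linear h).

Lemma linextM h a : linext h (M K a) = h a.
Proof. by rewrite /linext msuppU oner_eq0 big_seq_fset1 mcoeffUU scale1r. Qed.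

Lemma eq_linext h h' x : h =1 h' -> linext h x = linext h' x.
Proof. by move=> e; apply: eq_bigr => a _; rewrite e. Qed.

Lemma linext_sum (I : Type) (r : seq I) (h : I -> pfun -> V) x :
  \sum_(i <- r) linext (h i) x = linext (fun a => \sum_(i <- r) h i a) x.
Proof. by rewrite exchange_big; apply: eq_bigr => a _; rewrite scaler_sumr. Qed.
End LinearExtension.

Lemma linext_id (K : fieldType) (x : PFSym K) : linext (M K) x = x.
Proof.
rewrite [RHS]monalgE; apply: eq_bigr => a _; apply/malgP => b.
by rewrite mcoeffZ !mcoeffU mulr_natr.
Qed.

Lemma linext_comp (K : fieldType) (V : lmodType K) (g : pfun -> V)
    (h : pfun -> PFSym K) x :
  linext g (linext h x) = linext (fun a => linext g (h a)) x.
Proof. by rewrite [linext h x]/linext linear_sum; apply: eq_bigr => a _; rewrite linearZ. Qed.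

Section Product.
Variable K : fieldType.
Implicit Types (a b c : pfun) (x y z : PFSym K).
Local Notation M := (M K).
Local Notation mulM := (mulM K).

Lemma mulM_gen a b X W : lrset a = [fset x in X] -> uniq X ->
  [fset shift (size a) w | w in lrset b] = [fset x in W] -> uniq W ->
  mulM a b = \sum_(Y <- merges X W) M (pf_fset Y).
Proof.
move=> eX uX eW uW; rewrite /mulM /theta eX eW.
exact: (sum_matchings (fun Y : {fset word} => M (pf_of Y))).
Qed.

Lemma mulM_merges a b :
  mulM a b = \sum_(X <- merges (lr a) (map (shift (size a)) (lr b))) M (pf_fset X).
Proof.
apply: mulM_gen => //; [exact/heads_uniq/heads_lr|exact: shift_fset|].
exact/heads_uniq/uniq_heads_shift.
Qed.

Lemma mulM0l a : mulM pf_nil a = M a.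
Proof.
rewrite mulM_merges big_seq1 -[in RHS](pf_fset_lr a); congr (M (pf_fset _)).
rewrite map_id_in // => w _; rewrite /shift map_id_in // => x _; exact: addn0.
Qed.

Lemma mulM0r a : mulM a pf_nil = M a.
Proof. by rewrite mulM_merges merges_nil big_seq1 pf_fset_lr. Qed.

Lemma shift_inj k : injective (shift k).
Proof. by apply: inj_map; apply: addIn. Qed.

Lemma mulM_assoc a b c : linext (mulM^~ c) (mulM a b) = linext (mulM a) (mulM b c).
Proof.
rewrite !mulM_merges !linear_sum /=.
pose W := map (shift (size a)) (lr b).
pose Z := map (shift (size a)) (map (shift (size b)) (lr c)).
transitivity (\sum_(X <- merges (lr a) W) \sum_(Y <- merges X Z) M (pf_fset Y)).
  rewrite !big_seq; apply: eq_bigr => X /merges_lr[bX uX lX sX]; rewrite linextM.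
  apply: mulM_gen => //; first exact: heads_uniq.
    rewrite sX shift_fset /Z -map_comp; apply/fsetP => x; rewrite !inE; congr (_ \in _).
    apply: eq_map => w /=; rewrite /shift -map_comp; apply: eq_map => i /=.
    by rewrite -addnA (addnC (size b)).
  rewrite /Z map_inj_uniq; last exact: shift_inj.
  exact/heads_uniq/uniq_heads_shift.
rewrite merges_assoc /W /Z merges_map ?big_map; last by move=> u w; apply: map_cat.
rewrite !big_seq; apply: eq_bigr => X /merges_lr[bX uX lX sX]; rewrite linextM.
apply/esym; apply: mulM_gen => //; first exact/heads_uniq/heads_lr.
  by rewrite lX shift_fset.
by rewrite map_inj_uniq; [exact: heads_uniq|exact: shift_inj].
Qed.

Lemma pfmulA : associative (@pfmul K).
Proof.
move=> x y z; rewrite /pfmul.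
etransitivity; last (apply/esym; apply: linext_comp).
apply: eq_linext => a.
etransitivity; first apply: linext_comp.
etransitivity; last (apply/esym; apply: linext_comp).
apply: eq_linext => b.
etransitivity; first apply: linext_comp.
transitivity (linext (fun c => linext (mulM^~ c) (mulM a b)) z).
  by apply: eq_linext => c; apply/esym; exact: mulM_assoc.
rewrite mulM_merges; set r := merges _ _.
transitivity (\sum_(X <- r) linext (mulM (pf_fset X)) z).
  rewrite linext_sum; apply: eq_linext => c.
  by rewrite linear_sum; apply: eq_bigr => X _; exact: linextM.
by rewrite linear_sum; apply: eq_bigr => X _; apply/esym; exact: linextM.
Qed.

Lemma pfmul1l : left_id (M pf_nil) (@pfmul K).
Proof.
by move=> x; rewrite /pfmul linextM -[RHS]linext_id; apply: eq_linext => a; rewrite mulM0l.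
Qed.

Lemma pfmul1r : right_id (M pf_nil) (@pfmul K).
Proof.
by move=> x; rewrite /pfmul -[RHS]linext_id; apply: eq_linext => a;
   rewrite linextM mulM0r.
Qed.

Lemma pfmulDl : left_distributive (@pfmul K) +%R.
Proof. by move=> x y z; rewrite /pfmul linearD. Qed.

Lemma pfmulDr : right_distributive (@pfmul K) +%R.
Proof.
move=> x y z; rewrite /pfmul -big_split; apply: eq_bigr => a _.
by rewrite linearD scalerDr.
Qed.

Lemma M_neq0 a : M a != 0.
Proof. by rewrite monalgU_eq0 oner_eq0. Qed.

HB.instance Definition _ := GRing.Zmodule_isNzRing.Build (PFSym K)
  pfmulA pfmul1l pfmul1r pfmulDl pfmulDr (M_neq0 pf_nil).

Lemma pfmulZl (k : K) x y : k *: (x * y) = k *: x * y.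
Proof. by rewrite [RHS]linearZ. Qed.
HB.instance Definition _ := GRing.Lmodule_isLalgebra.Build K (PFSym K) pfmulZl.

Lemma pfmulZr (k : K) x y : k *: (x * y) = x * (k *: y).
Proof.
rewrite scaler_sumr; apply: eq_bigr => a _; rewrite [in RHS]linearZ /= !scalerA.
by congr (_ *: _); exact: mulrC.
Qed.
HB.instance Definition _ := GRing.Lalgebra_isAlgebra.Build K (PFSym K) pfmulZr.

Lemma one_PFSym : 1 = M pf_nil :> PFSym K.
Proof. by []. Qed.

Lemma mul_PFSym a b :
  M a * M b = \sum_(T <- matchings (lrset a) [fset shift (size a) w | w in lrset b])
                M (theta a b T).
Proof. by rewrite [LHS]linextM linextM. Qed.
End Product.

(* Universal property of the free associative unital algebra on the subset S of
   B: every map S -> A into a K-algebra extends to a unique algebra morphism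
   B -> A.  Maps on S are given as restrictions to S of maps on B. *)
Definition freely_generates (K : fieldType) (B : algType K) (S : B -> Prop) : Prop :=
  forall (A : algType K) (f : B -> A),
  exists g : {lrmorphism B -> A},
    (forall x, S x -> g x = f x) /\
    (forall g' : {lrmorphism B -> A}, (forall x, S x -> g' x = f x) -> g' =1 g).

(* Main.v *)
(* Among the terms of M_b * M_c, the split product b o c is the unique minimizer
   of the sum of i * phi(w_i) over the blocks w_i, where phi is additive and
   weighs small letters so heavily that it decreases along the blocks: this is
   the rearrangement inequality.  Hence M_b * M_c = M_(b o c) + terms that are
   smaller for a suitable nat-valued measure.  Moreover the split product acts
   blockwise by concatenation, so it satisfies Levi's lemma and every nonempty
   parking function has a unique decomposition a = u o c with u unsplitable (c
   may be empty).  A map f on the unsplitables therefore extends by the recursion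
   h(a) = f(M_u) h(c) - h(M_u * M_c - M_a), and an induction on the same measure
   shows that the linear extension of h is multiplicative and is the only
   algebra morphism extending f. *)
Require Import Defs.
From mathcomp Require Import all_boot all_order all_algebra.
From HB Require Import structures.
From mathcomp Require Import finmap monalg zify.
From Stdlib Require Import Classical_Prop IndefiniteDescription.
(* Imported again because fintype also defines split. *)
Import Defs GRing.Theory.

Set Implicit Arguments.
Unset Strict Implicit.
Unset Printing Implicit Defensive.

Local Open Scope nat_scope.

(** * The cost of a sequence of blocks *)

Section Cost.
Variable phi : word -> nat.

Definition wsum (X : seq word) : nat := \sum_(w <- X) phi w.

(* cost (w_1, ..., w_s) is the sum of i * phi w_i. *)
Fixpoint cost (X : seq word) : nat :=
  if X is _ :: X' then wsum X + cost X' else 0.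

Lemma wsum_cons w X : wsum (w :: X) = phi w + wsum X.
Proof. by rewrite /wsum big_cons. Qed.

Lemma wsum_sel W p : p \in sel W -> wsum W = phi p.1 + wsum p.2.
Proof. by move=> /sel_perm pW; rewrite -wsum_cons /wsum (perm_big _ pW). Qed.

Lemma cost_le X : cost X <= size X * wsum X.
Proof. by elim: X => //= w X IH; rewrite wsum_cons; nia. Qed.

Definition decreasing (W : seq word) : bool :=
  pairwise (fun v w => phi w < phi v) W.

Lemma decreasing_sel W p : decreasing W -> p \in sel W -> decreasing p.2.
Proof.
elim: W p => [|w W IH] p //= /andP[wW dW].
rewrite inE => /orP[/eqP->//|/mapP[q qW ->]] /=.
have /allP wq : all (fun v => phi v < phi w) (q.1 :: q.2).
  by rewrite -(perm_all _ (sel_perm qW)).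
rewrite /decreasing /= -/(decreasing _) IH // andbT.
by apply/allP => x xq; apply: wq; rewrite inE xq orbT.
Qed.

(** If [p.1] is the j-th entry of [W], dropping it loses j times its weight, while [w] in front and
    the j-1 earlier entries, each moved one place later, add j weights, all larger. *)
Lemma cost_sel w W p : decreasing (w :: W) -> p \in sel W ->
  cost W < cost (w :: p.2).
Proof.
rewrite /decreasing /=.
elim: W w p => [|v W IH] w p //= /andP[/andP[vw Ww] dW].
rewrite inE => /orP[/eqP->|/mapP[q qW ->]] /=; rewrite !wsum_cons ?ltn_add2r //.
have qw : phi q.1 < phi w.
  have := sel_perm qW => /perm_mem/(_ q.1); rewrite mem_head.
  by move/(allP Ww).
by have := IH _ _ dW qW; rewrite /= wsum_cons (wsum_sel qW); case: q qw {qW} => /= *; lia.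
Qed.

Hypothesis phi_cat : forall u w, phi (u ++ w) = phi u + phi w.

Lemma wsum_merges U W X : X \in merges U W -> wsum X = wsum U + wsum W.
Proof.
elim: U W X => [|u U IH] W X.
  by rewrite inE => /eqP->; rewrite /wsum big_nil.
rewrite /= mem_cat => /orP[/mapP[Y /IH YM ->]|/allpairsPdep[[v V] [Y [pW /IH /= YM ->]]]].
  by rewrite !wsum_cons YM addnA.
by rewrite !wsum_cons YM (wsum_sel pW) phi_cat /=; lia.
Qed.

(** Every word of [U] and of the shifted [W] keeps its index, and [phi] is additive. *)
Lemma cost_split k U W :
  cost (split_words k U W) = cost U + cost (map (shift k) W).
Proof.
have mX U' W' := wsum_merges (split_words_merges k U' W').
elim: U W => [|u U IH] [|w W] //; first by rewrite /= addn0.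
by have := mX (u :: U) (w :: W); move: (IH W) => /= -> ->; lia.
Qed.

Lemma cost_merges U W X : decreasing W -> X \in merges U W ->
  cost U + cost W <= cost X.
Proof.
elim: U W X => [|u U IH] W X dW; first by rewrite inE => /eqP->.
rewrite /= mem_cat => /orP[/mapP[Y YM ->]|/allpairsPdep[p [Y [pW YM ->]]]].
  have := IH _ _ dW YM; have := wsum_merges YM.
  by rewrite /= !wsum_cons; lia.
case: p pW YM => v V /= pW YM.
have := IH _ _ (decreasing_sel dW pW) YM.
have := wsum_merges YM; rewrite /= !wsum_cons phi_cat /=.
(* The right-hand side is [cost (v :: V)]: bringing an entry of a decreasing sequence to the front
   cannot lower the cost. *)
suff : cost W <= phi v + wsum V + cost V by lia.
case: W dW pW {YM} => [|w W] // dW; rewrite /= inE => /orP[/eqP[-> ->]|].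
  by rewrite wsum_cons.
case/mapP=> -[q1 q2] /= qW [-> ->] /=; have := cost_sel dW qW.
by rewrite /= !wsum_cons (wsum_sel qW) /=; lia.
Qed.

(** Listing the split once in front gives it multiplicity one. Any other outcome is dearer: either
    the first block of [U] stays alone, so that all of [W], of positive weight, counts once more; or
    it takes a later block of [W], where [cost_sel] is strict; or the first blocks are joined and
    induction applies to the tails. *)
Lemma split_words_min k U W : all (fun w => 0 < phi w) (map (shift k) W) ->
  decreasing (map (shift k) W) ->
  exists2 L, perm_eq (merges U (map (shift k) W)) (split_words k U W :: L) &
    {in L, forall X, cost (split_words k U W) < cost X}.
Proof.
elim: U W => [|u U IH] [|w W] pW dW; try by exists [::].
  by exists [::] => //; rewrite [map _ _]/= merges_nil.
have [/= pw pW'] := andP pW; have [_ dW'] := andP dW.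
have [L0 pL0 hL0] := IH W pW' dW'.
rewrite [merges _ _]/=.
set A := map _ _; set B := flatten _.
exists (A ++ [seq (u ++ shift k w) :: X | X <- L0] ++ B).
  rewrite perm_sym -cat1s perm_catCA perm_cat2l catA perm_cat2r /=.
  by rewrite perm_sym; apply: (perm_map (cons (u ++ shift k w))) pL0.
move=> X; rewrite [X in X < _](cost_split k (u :: U) (w :: W)) !mem_cat.
case/or3P=> [/mapP[Y YM ->]|/mapP[Y YL ->]|].
- have := cost_merges dW YM; have := wsum_merges YM.
   by rewrite /= !wsum_cons; lia.
- have YM : Y \in merges U (map (shift k) W).
    by rewrite (perm_mem pL0) inE YL orbT.
  have := hL0 _ YL; rewrite cost_split; have := wsum_merges YM.
  by rewrite /= !wsum_cons phi_cat; lia.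
case/allpairsPdep=> p [Y [/mapP[[q1 q2] qW ->] /= YM ->]].
have pW1 : (q1, shift k w :: q2) \in sel (map (shift k) (w :: W)).
  by rewrite /= inE; apply/orP; right; apply/mapP; exists (q1, q2).
have := cost_merges (decreasing_sel dW pW1) YM; have := wsum_merges YM.
have : cost (map (shift k) W) < cost (shift k w :: q2) := cost_sel dW qW.
by rewrite /= !wsum_cons (wsum_sel qW) phi_cat /=; lia.
Qed.
End Cost.

(** * The order of the blocks in the terms of a product *)

Lemma merges_heads_cat (U W X : seq word) : all block U -> X \in merges U W ->
  exists2 W', subseq W' W & heads X = heads U ++ heads W'.
Proof.
have sel_subseq (V : seq word) p : p \in sel V -> subseq p.2 V.
  elim: V p => [|v V IH] p //; rewrite /sel inE -/sel => /orP[/eqP->|].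
    exact: subseq_cons.
  by case/mapP=> q /IH h ->; rewrite /= eqxx.
elim: U W X => [|u U IH] W X /=; first by move=> _; rewrite inE => /eqP->; exists W.
case/andP=> /andP[nu _] bU; rewrite mem_cat => /orP[/mapP[Y YM ->]|].
  by have [W' sW' /= ->] := IH _ _ bU YM; exists W'.
case/allpairsPdep=> p [Y [pW YM ->]].
have [W' sW' /= ->] := IH _ _ bU YM; exists W'; last by case: u nu.
exact: subseq_trans sW' (sel_subseq _ _ pW).
Qed.

Lemma head_mem (w : word) : w != [::] -> head 0 w \in w.
Proof. by case: w => // x w _; rewrite mem_head. Qed.

(** A joined word keeps the minimum of its left part, so the minima of [X] are those of [lr a]
    followed by some of the shifted ones, which exceed [size a]. Hence [X] is already sorted, and
    costs, which depend on the order, can be read off it. *)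
Lemma lr_pf_fset (a b : pfun) X : X \in merges (lr a) (map (shift (size a)) (lr b)) ->
  lr (pf_fset X) = X /\ size (pf_fset X) = size a + size b.
Proof.
move=> XM; have [bX uX _ sX] := merges_lr XM; split=> //.
have [/andP[ba sa] _] := lrP a; have [/andP[bb sb] _] := lrP b.
have [W' sW' eX] := merges_heads_cat ba XM.
have lX : lrseq X.
  rewrite /lrseq bX -/(heads X) eX /= sorted_pairwise; last exact: ltn_trans.
  rewrite pairwise_cat -!sorted_pairwise; try exact: ltn_trans.
  rewrite sa /=; apply/andP; split; last first.
    apply: (subseq_sorted ltn_trans (map_subseq _ sW')).
    rewrite -/(heads _) heads_shift // sorted_map.
    by apply: sub_sorted sb => x y /=; rewrite ltn_add2r.
  apply/allrelP => _ _ /mapP[u ua ->] /mapP[w /(mem_subseq sW') wb ->].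
  have /andP[/andP[nu _] /allP hu] := allP (low_lr a) _ ua.
  have /andP[/andP[nw _] /allP hw] := allP (high_lr (size a) b) _ wb.
  exact: leq_ltn_trans (hu _ (head_mem nu)) (hw _ (head_mem nw)).
have pX := perm_fset (heads_uniq uX).
have pf : perm_eq (flatten X) (a ++ shift (size a) b).
  apply: perm_trans (merges_flatten XM) _; apply: perm_cat (perm_lr a) _.
  by rewrite -map_flatten; apply/perm_map/perm_lr.
rewrite /pf_fset (pf_ofE (perm_trans (perm_flatten pX) pf) (parking_cat (valP a) (valP b))).
rewrite (perm_assemble _ pX); last by rewrite (perm_uniq (perm_map _ pX)).
by rewrite lr_assemble_sorted // lr_unique.
Qed.

(** * A measure making the product triangular *)

(** In base [n.+1], one letter outweighs any n larger letters that are at most n. *)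
Definition weight (n : nat) (w : word) : nat := \sum_(x <- w) n.+1 ^ (n - x).

Lemma weight_cat n u w : weight n (u ++ w) = weight n u + weight n w.
Proof. by rewrite /weight big_cat. Qed.

Lemma weight_ub n h w : all (leq h) w -> weight n w <= size w * n.+1 ^ (n - h).
Proof.
elim: w => [|x w IH] /=; first by rewrite /weight big_nil.
case/andP=> hx /IH; rewrite /weight big_cons.
have : n.+1 ^ (n - x) <= n.+1 ^ (n - h) by rewrite leq_pexp2l // leq_sub2l.
by nia.
Qed.

Lemma weight_lb n w : block w -> n.+1 ^ (n - head 0 w) <= weight n w.
Proof. by case: w => // x w _; rewrite /weight big_cons leq_addr. Qed.

Lemma weight_lt n v w : block v -> block w -> size w <= n -> all (geq n) w ->
  head 0 v < head 0 w -> weight n w < weight n v.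
Proof.
move=> bv bw sw lw vw; apply: leq_trans (weight_lb n bv).
have [nw hw] := andP bw; apply: leq_ltn_trans (weight_ub n hw) _.
(* As subtraction is truncated, this bound is what makes the two exponents differ. *)
have hn : head 0 w <= n := allP lw _ (head_mem nw).
have -> : n - head 0 v = (head 0 w - head 0 v).-1 + (n - head 0 w).+1 by lia.
rewrite expnD expnS mulnA.
rewrite -[X in X < _]mul1n mulnA ltn_pmul2r ?expn_gt0 // mul1n.
by apply: leq_trans (leq_pmull _ _); rewrite ?expn_gt0.
Qed.

Lemma wsum_weight n X : wsum (weight n) X = weight n (flatten X).
Proof.
elim: X => [|w X IH]; first by rewrite /wsum /weight !big_nil.
by rewrite wsum_cons IH /= weight_cat.
Qed.

Lemma size_lr a : size (lr a) <= size a.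
Proof.
have [/andP[ba _] _] := lrP a; rewrite -(perm_size (perm_lr a)).
elim: (lr a) ba => //= w X IH /andP[/andP[nw _] /IH h]; rewrite size_cat.
by case: w nw => //= x w _; lia.
Qed.

Definition pfcost (a : pfun) : nat := cost (weight (size a)) (lr a).

Definition cost_bound (n : nat) : nat := n * (n * n.+1 ^ n).

Lemma pfcost_le a : pfcost a <= cost_bound (size a).
Proof.
apply: leq_trans (cost_le _ _) (leq_mul (size_lr a) _).
rewrite wsum_weight /weight (perm_big _ (perm_lr a)) -/(weight _ _).
have := @weight_ub (size a) 0 a; rewrite subn0; apply.
exact/allP.
Qed.

(* A shorter word has a smaller measure; at equal length, a larger cost. *)
Definition mu (a : pfun) : nat :=
  \sum_(j < (size a).+1) (cost_bound j).+1 - pfcost a.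

Lemma mu_size (a b : pfun) : size a < size b -> mu a < mu b.
Proof.
(* The top summand, thanks to its successor, exceeds [pfcost b]; the summands below it already cover
   the whole sum for [a]. *)
move=> ab; rewrite /mu [X in _ < X - _]big_ord_recr /=; have := pfcost_le b.
set s := \sum_(j < _) _; set t := \sum_(j < _) _.
suff : s <= t by lia.
rewrite /s /t -!(big_mkord xpredT (fun j => (cost_bound j).+1)).
by rewrite (big_cat_nat _ ab) //= leq_addr.
Qed.

Lemma mu_cost (a b : pfun) : size a = size b -> pfcost b < pfcost a -> mu a < mu b.
Proof.
move=> ab; rewrite /mu ab; have := pfcost_le a; rewrite ab big_ord_recr /=.
by lia.
Qed.

Lemma perm_split (b c : pfun) : perm_eq (split b c) (b ++ shift (size b) c).
Proof.
have XM := split_words_merges (size b) (lr b) (lr c).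
apply: (@perm_trans _ (flatten (lr (split b c)))); first by rewrite perm_sym perm_lr.
rewrite lr_split; apply: perm_trans (merges_flatten XM) _; rewrite -map_flatten.
by apply: perm_cat; [exact: perm_lr|exact/perm_map/perm_lr].
Qed.

Lemma split_size (b c : pfun) : size (split b c) = size b + size c.
Proof. by rewrite (perm_size (perm_split b c)) size_cat size_map. Qed.

Lemma decreasing_shift_lr (a b : pfun) n : size a + size b <= n ->
  decreasing (weight n) (map (shift (size a)) (lr b)).
Proof.
move=> abn; have [/andP[bb sb] _] := lrP b.
pose P w := [&& block w, size w <= n & all (geq n) w].
have hP : all P (map (shift (size a)) (lr b)).
  apply/allP => _ /mapP[v vb ->].
  have /andP[bw _] := allP (high_lr (size a) b) _ (map_f (shift (size a)) vb).
  have /andP[_ /allP vle] := allP (low_lr b) _ vb.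
  rewrite /P bw size_map /=; apply/andP; split.
    apply: (leq_trans _ (leq_trans (leq_addl _ _) abn)).
    rewrite -(perm_size (perm_lr b)) size_flatten.
    elim: (lr b) vb => //= u X IH; rewrite inE => /orP[/eqP->|/IH]; lia.
  apply/allP => _ /mapP[x /vle /= xb ->] /=; lia.
have : pairwise (relpre (head 0) ltn) (map (shift (size a)) (lr b)).
  rewrite -pairwise_map -/(heads _) heads_shift // -sorted_pairwise; last exact: ltn_trans.
  by rewrite sorted_map; apply: sub_sorted sb => x y /=; rewrite ltn_add2r.
apply: (sub_in_pairwise (P := P)) hP => v w /and3P[bv _ _] /and3P[bw sw lw] /=.
exact: weight_lt.
Qed.

Lemma mul_split (K : fieldType) (b c : pfun) :
  exists2 L : seq pfun, (M K b * M K c)%R = (M K (split b c) + \sum_(x <- L) M K x)%R &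
    {in L, forall x, mu x < mu (split b c)}.
Proof.
have dW := decreasing_shift_lr (leqnn (size b + size c)).
have pW : all (fun w => 0 < weight (size b + size c) w) (map (shift (size b)) (lr c)).
  apply/allP => w wc; have /andP[bw _] := allP (high_lr (size b) c) _ wc.
  by apply: leq_trans (weight_lb _ bw); rewrite expn_gt0.
have [L pL hL] := split_words_min (weight_cat _) (lr b) pW dW.
exists (map pf_fset L).
  rewrite [LHS]linextM linextM mulM_merges (perm_big _ pL) big_cons big_map.
  by rewrite -lr_split pf_fset_lr.
move=> _ /mapP[X XL ->].
have XM : X \in merges (lr b) (map (shift (size b)) (lr c)).
  by rewrite (perm_mem pL) inE XL orbT.
have [lX sX] := lr_pf_fset XM.
apply: mu_cost; first by rewrite sX split_size.
by rewrite /pfcost lX sX split_size lr_split; apply: hL.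
Qed.

(** * Unique factorization for the split product *)

(* The i-th block of a, or the empty word past the last block: with this
   convention the split product acts blockwise. *)
Definition blk (a : word) (i : nat) : word := nth [::] (lr a) i.

Lemma blk_split (b c : pfun) i :
  blk (split b c) i = blk b i ++ shift (size b) (blk c i).
Proof.
have nth_shift W j : nth [::] (map (shift (size b)) W) j = shift (size b) (nth [::] W j).
  by elim: W j => [|w W IH] [|j] /=.
rewrite /blk lr_split; elim: (lr b) (lr c) i => [|u U IH] [|w W] i.
- by rewrite !nth_nil.
- by rewrite nth_nil -nth_shift.
- by rewrite nth_nil cats0.
by case: i => [|i] //=.
Qed.

Lemma lr_nonempty a : all (predC1 [::]) (lr a).
Proof. by have [/andP[ba _] _] := lrP a; apply: sub_all ba => w /andP[]. Qed.

(** Blocks are nonempty, so padding by empty words does not hide where the list ends. *)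
Lemma blk_inj (a b : pfun) : blk a =1 blk b -> a = b.
Proof.
move=> ab; rewrite -(pf_of_lr a) -(pf_of_lr b); congr pf_of.
move: (lr_nonempty a) (lr_nonempty b) (ab : nth _ _ =1 nth _ _).
elim: (lr a) (lr b) => [|u U IH] [|w W] //=.
- by move=> _ /andP[nw _] /(_ 0) /= ew; rewrite -ew in nw.
- by move=> /andP[nu _] _ /(_ 0) /= eu; rewrite eu in nu.
move=> /andP[_ nU] /andP[_ nW] e; have /= -> := e 0.
by rewrite (IH W) // => i; have := e i.+1.
Qed.

Lemma blk_letter (a : pfun) i x : x \in blk a i -> 0 < x <= size a.
Proof.
move=> xa; have [/allP ha _] := andP (valP a); apply: ha.
rewrite -(perm_mem (perm_lr a)); apply/flattenP; exists (blk a i) => //.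
apply: mem_nth; rewrite ltnNge; apply/negP => h.
by rewrite /blk nth_default in xa.
Qed.

Lemma split_nil_r (b : pfun) : split b pf_nil = b.
Proof. by apply: blk_inj => i; rewrite blk_split /blk nth_nil cats0. Qed.

Lemma split_assoc (a b c : pfun) : split a (split b c) = split (split a b) c.
Proof.
apply: blk_inj => i; rewrite !blk_split split_size -catA.
rewrite /shift map_cat -map_comp; congr (_ ++ (_ ++ _)).
by apply: eq_map => x /=; rewrite -addnA (addnC (size a)).
Qed.

(** Sorting puts the letters of [b] first, so the bound at position [size b + i] of the whole word
    is, after subtracting [size b], the bound at position [i] for [d]. *)
Lemma parking_catr b d : all (leq 1) d -> all (geq (size b)) b ->
  parking (b ++ shift (size b) d) -> parking d.
Proof.
move=> pd lb /andP[ld pp]; rewrite size_cat size_map in ld pp.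
apply/andP; split.
  apply/allP => x xd; rewrite (allP pd _ xd : 0 < x) /=.
  have := allP ld (x + size b).
  rewrite mem_cat (map_f (addn^~ (size b)) xd : _ \in shift _ _) orbT => /(_ isT) /=.
  by lia.
have e : sort leq (b ++ shift (size b) d) = sort leq b ++ shift (size b) (sort leq d).
  apply: (sorted_eq leq_trans anti_leq); first exact/sort_sorted/leq_total.
    rewrite sorted_pairwise; last exact: leq_trans.
    rewrite pairwise_cat -!sorted_pairwise; try exact: leq_trans.
    rewrite sort_sorted /=; last exact: leq_total.
    apply/andP; split.
      apply/allrelP => x z; rewrite mem_sort => /(allP lb) /= xb /mapP[y _ ->].
      exact: leq_trans xb (leq_addl _ _).
    rewrite sorted_map; apply: sub_sorted (sort_sorted leq_total d) => x y /=.
    by rewrite leq_add2r.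
  rewrite (permPl (permEl (perm_sort _ _))) perm_sym perm_cat //.
    exact: permEl (perm_sort _ _).
  exact/perm_map/permEl/perm_sort.
apply/allP => i; rewrite mem_iota /= add0n => id.
have := allP pp (size b + i); rewrite mem_iota /= add0n ltn_add2l => /(_ id).
rewrite e nth_cat size_sort ltnNge leq_addr /= addnC addnK.
by rewrite (nth_map 0) ?size_sort //; lia.
Qed.

(** Blocks that would become empty are dropped, so that the result is again an LR-decomposition.
    When the minima increase, these blocks form a tail, and the others keep their indices. *)
Definition low_words (k : nat) (W : seq word) : seq word :=
  [seq [seq x <- w | x <= k] | w <- W & head 0 w <= k].

Lemma filter_block_high k w : block w -> k < head 0 w -> [seq x <- w | x <= k] = [::].
Proof.
case/andP=> _ /allP hw kw; rewrite (@eq_in_filter _ _ pred0) ?filter_pred0 // => x.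
by move=> /hw /= wx; lia.
Qed.

Lemma nth_low_words k W i : lrseq W ->
  nth [::] (low_words k W) i = [seq x <- nth [::] W i | x <= k].
Proof.
rewrite /low_words; elim: W i => [|w W IH] i; first by rewrite !nth_nil.
case/andP=> /= /andP[bw bW] pW.
have sW : lrseq W by rewrite /lrseq bW (path_sorted pW).
case: leqP => [hw|kw]; first by case: i => [|i] //=; apply: IH.
have [wi|iw] := ltnP i (size (w :: W)); last first.
  rewrite (nth_default _ iw) /= nth_default // size_map.
  by apply: leq_trans iw; rewrite /= ltnW // ltnS size_filter count_size.
have hi : all (fun v => k < head 0 v) (w :: W).
  rewrite /= kw; apply/allP => v vW.
  have /allP/(_ (head 0 v)) := order_path_min ltn_trans pW.
  by rewrite map_f // => /(_ isT); apply: ltn_trans.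
rewrite (_ : [seq v <- W | _] = [::]) ?nth_nil.
  rewrite filter_block_high //.
    by apply: (allP (_ : all block (w :: W))); [rewrite /= bw|exact: mem_nth].
  exact: (allP hi _ (mem_nth _ wi)).
rewrite (@eq_in_filter _ _ pred0) ?filter_pred0 // => v vW.
by have := allP hi v; rewrite inE vW orbT => /(_ isT); rewrite ltnNge => /negbTE.
Qed.

Lemma flatten_low_words k W : all block W ->
  flatten (low_words k W) = [seq x <- flatten W | x <= k].
Proof.
rewrite /low_words; elim: W => //= w W IH /andP[bw /IH IH']; rewrite filter_cat -IH'.
by case: leqP => // kw; rewrite filter_block_high.
Qed.

Lemma lrseq_low_words k W : lrseq W -> lrseq (low_words k W).
Proof.
have hd w : block w -> head 0 w <= k -> head 0 [seq x <- w | x <= k] = head 0 w.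
  by case: w => //= x w _ ->.
case/andP=> bW sW; apply/andP; split.
  apply/allP => _ /mapP[w + ->]; rewrite mem_filter => /andP[kw /(allP bW) bw].
  rewrite /block hd //; case/andP: (bw) => nw /allP hw; apply/andP; split.
    by case: w kw nw {bw hw} => //= x w ->.
  by apply/allP => x; rewrite mem_filter => /andP[_ /hw].
apply: (subseq_sorted ltn_trans _ sW).
rewrite -map_comp.
rewrite (_ : map _ _ = [seq head 0 w | w <- W & head 0 w <= k]).
  exact/map_subseq/filter_subseq.
apply/eq_in_map => w; rewrite mem_filter => /andP[kw /(allP bW) bw].
exact: hd.
Qed.

(* Levi's lemma for the monoid of parking functions under the split product. *)
Lemma split_levi (b c b' c' : pfun) : split b c = split b' c' -> size b <= size b' ->
  exists2 d, b' = split b d & c = split d c'.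
Proof.
move=> e sbb'; pose k := size b' - size b.
have filter_le m (w : word) : all (geq m) w -> [seq x <- w | x <= m] = w.
  by move=> h; apply/all_filterP.
have filter_shift_le m n (w : word) : m <= n ->
    [seq x <- shift m w | x <= n] = shift m [seq x <- w | x <= n - m].
  move=> mn; rewrite /shift filter_map; congr map; apply: eq_filter => x /=.
  by rewrite leq_subRL // addnC.
have filter_shift_gt m (w : word) : all (leq 1) w -> [seq x <- shift m w | x <= m] = [::].
  move=> hw; rewrite filter_shift_le // subnn (@eq_in_filter _ _ pred0) ?filter_pred0 //.
  by move=> x /(allP hw) /=; case: x.
have le_word (a : pfun) m : size a <= m -> all (geq m) a.
  move=> am; have [/allP ha _] := andP (valP a); apply/allP => x /ha /andP[_ /= xa].
  exact: leq_trans xa am.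
have gt_word (a : pfun) : all (leq 1) a.
  by have [/allP ha _] := andP (valP a); apply/allP => x /ha /andP[].
(* Keeping the letters up to [size b'] in both factorizations leaves [b'] on one side, and [b] with
   the small letters of [c] on the other. *)
have b'E : perm_eq b' (b ++ shift (size b) [seq x <- c | x <= k]).
  have := perm_split b' c'; rewrite -e perm_sym => /perm_trans/(_ (perm_split b c)).
  move/(perm_filter (geq (size b'))); rewrite !filter_cat.
  rewrite (filter_le _ _ (le_word b' _ (leqnn _))) // filter_shift_gt // cats0.
  by rewrite (filter_le _ _ (le_word b _ sbb')) // filter_shift_le.
(* The witness [d] is [c] truncated at [k] in each block; [b'E] makes it a parking function. *)
pose D := low_words k (lr c).
have [lc _] := lrP c.
have lD : lrseq D := lrseq_low_words k lc.
have pD : perm_eq (flatten (rev D)) [seq x <- c | x <= k].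
  apply: (@perm_trans _ (flatten D)); first by apply: perm_flatten; rewrite perm_rev.
  have [bc _] := andP lc.
  by rewrite flatten_low_words //; apply/perm_filter/perm_lr.
have parkD : parking (flatten (rev D)).
  rewrite (parking_perm pD); apply: (@parking_catr b).
  - by apply/allP => x; rewrite mem_filter => /andP[_]; apply: (allP (gt_word c)).
  - exact: le_word.
  by rewrite -(parking_perm b'E); apply: valP.
pose d := PFun parkD.
have sd : size d = k by rewrite /k (perm_size b'E) size_cat size_map (perm_size pD) addKn.
have blk_le (a : pfun) i m : size a <= m -> all (geq m) (blk a i).
  by move=> am; apply/allP => x /blk_letter/andP[_ xa]; apply: leq_trans xa am.
have blk_gt (a : pfun) i : all (leq 1) (blk a i).
  by apply/allP => x /blk_letter/andP[].
have E i : blk b i ++ shift (size b) (blk c i) = blk b' i ++ shift (size b') (blk c' i).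
  by rewrite -!blk_split e.
have blkd i : blk d i = [seq x <- blk c i | x <= k].
  by rewrite /blk /= lr_unique // nth_low_words.
(* The same truncation, now block by block. *)
have E' i : blk b' i = blk b i ++ shift (size b) (blk d i).
  have := congr1 (filter (geq (size b'))) (E i); rewrite !filter_cat.
  rewrite (filter_le _ _ (blk_le b' _ _ (leqnn _))) filter_shift_gt // cats0 => <-.
  by rewrite (filter_le _ _ (blk_le b _ _ sbb')) filter_shift_le // blkd.
exists d; apply: blk_inj => i; rewrite blk_split //.
have /eqP := E i; rewrite E' -catA eqseq_cat // eqxx /= => /eqP h.
apply: (@shift_inj (size b)); rewrite h sd /shift map_cat -map_comp; congr (_ ++ _).
by apply: eq_map => x /=; rewrite -addnA subnK.
Qed.

Lemma size_nil0 (a : pfun) : size a = 0 -> a = pf_nil.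
Proof. by move=> /size0nil a0; apply: val_inj. Qed.

(** By associativity, an unsplitable first factor of a shorter left factor is also one of [a]. *)
Lemma unsplitable_factor (a : pfun) : a <> pf_nil ->
  exists p : pfun * pfun, unsplitable p.1 /\ a = split p.1 p.2.
Proof.
have [n le_an] := ubnP (size a); elim: n a le_an => // n IH a an a0.
case: (classic (unsplitable a)) => [ua|nua].
  by exists (a, pf_nil); rewrite split_nil_r.
have [[b [c [b0 c0 ea]]]|ns] := classic
  (exists b c : pfun, [/\ b <> pf_nil, c <> pf_nil & a = split b c]); last by case: nua.
have sc : size c != 0 by apply/eqP => /size_nil0.
have [|[u d] /= [uu eb]] := IH b _ b0; first by have := split_size b c; rewrite -ea; lia.
by exists (u, split d c); split=> //=; rewrite split_assoc -eb.
Qed.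

(** By Levi's lemma the longer of the two first factors is the shorter one times some [d], which
    must be empty. *)
Lemma unsplitable_factor_inj (u c u' c' : pfun) : unsplitable u -> unsplitable u' ->
  split u c = split u' c' -> u = u' /\ c = c'.
Proof.
wlog uu' : u c u' c' / size u <= size u'.
  move=> H Uu Uu' e; have [uu'|/ltnW uu'] := leqP (size u) (size u'); first exact: H.
  by have [-> ->] := H _ _ _ _ uu' Uu' Uu (esym e).
move=> [u0 _] [_ u's] e; have [d eu' ec] := split_levi e uu'.
have [d0|d0] := eqVneq d pf_nil; last first.
  by case: u's; exists u, d; split=> //; apply/eqP.
rewrite eu' ec d0 split_nil_r; split=> //; apply: blk_inj => i.
rewrite blk_split /blk nth_nil /shift map_id_in // => x _; exact: addn0.
Qed.

(** * The universal property *)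

(** The iterates of [F] from the constant [y0] have a stable value at [a] after [(m a).+1] steps;
    the stable values form the fixed point. *)
Lemma measure_fixpoint (S T : Type) (m : S -> nat) (y0 : T) (F : (S -> T) -> S -> T) :
  (forall a g g', (forall x, m x < m a -> g x = g' x) -> F g a = F g' a) ->
  exists h, forall a, h a = F h a.
Proof.
move=> locF.
have [h hS] : exists h : nat -> S -> T, forall k, h k.+1 = F (h k).
  by exists (fun k => iter k F (fun=> y0)).
have stable k a : m a < k -> h k a = h (m a).+1 a.
  elim/ltn_ind: k a => -[|k] // IH a ak; rewrite !hS; apply: locF => x xa.
  rewrite (IH k) //; last exact: leq_trans xa ak.
  by rewrite (IH (m a)).
exists (fun a => h (m a).+1 a) => a; rewrite hS; apply: locF => x xa.
by rewrite stable.
Qed.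

Local Open Scope ring_scope.

Theorem theorem4p3 (K : fieldType) (charK0 : [pchar K]%R =i pred0) :
  freely_generates (fun x : PFSym K => exists2 a : pfun, unsplitable a & x = M K a).
Proof.
move=> A f.
have [fac facP] : exists fac : pfun -> pfun * pfun, forall a, a <> pf_nil ->
    unsplitable (fac a).1 /\ a = split (fac a).1 (fac a).2.
  apply: (functional_choice (fun a p => a <> pf_nil -> unsplitable p.1 /\ a = split p.1 p.2)).
  move=> a; have [->|/eqP a0] := eqVneq a pf_nil; first by exists (pf_nil, pf_nil).
  by have [p hp] := unsplitable_factor a0; exists p.
pose low u c : PFSym K := M K u * M K c - M K (split u c).
have lowE u c : exists2 L : seq pfun, low u c = \sum_(x <- L) M K x &
    {in L, forall x, (mu x < mu (split u c))%N}.
  by have [L eL hL] := mul_split K u c; exists L => //; rewrite /low eL addrC addKr.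
have linext_low (V : lmodType K) (g g' : pfun -> V) u c :
    (forall x, (mu x < mu (split u c))%N -> g x = g' x) ->
    linext g (low u c) = linext g' (low u c).
  move=> gg'; have [L -> hL] := lowE u c; rewrite !linear_sum /= !big_seq.
  by apply: eq_bigr => x xL; rewrite !linextM; apply/gg'/hL.
have mu_fac u c : unsplitable u -> (mu c < mu (split u c))%N.
  case=> u0 _; apply: mu_size; rewrite split_size.
  have : size u <> 0%N by move=> /size_nil0.
  lia.
pose F (g : pfun -> A) a : A := if a == pf_nil then 1 else
  let: (u, c) := fac a in f (M K u) * g c - linext g (low u c).
have [h hE] : exists h, forall a, h a = F h a.
  apply: (@measure_fixpoint _ _ mu 0) => a g g' gg'; rewrite /F.
  case: eqVneq => // /eqP a0; have := facP a a0; case: (fac a) => u c /= [uu ea].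
  rewrite gg' ?ea ?mu_fac //; congr (_ - _); apply: linext_low => x xa.
  by apply: gg'; rewrite ea.
have h1 : h pf_nil = 1 by rewrite hE /F eqxx.
(* Unique factorization identifies the pair chosen by [fac] with the given one. *)
have splitP u c : unsplitable u -> h (split u c) = f (M K u) * h c - linext h (low u c).
  move=> uu; rewrite hE /F.
  have s0 : split u c <> pf_nil.
    case: uu => u0 _ /(congr1 (size \o pfword)); rewrite /= split_size => /eqP.
    by rewrite addn_eq0 => /andP[/eqP/size_nil0].
  rewrite (introF eqP s0); have := facP _ s0; case: (fac _) => u' c' /= [uu' e].
  by have [-> ->] := unsplitable_factor_inj uu' uu (esym e).
have ind (P : pfun -> Prop) : P pf_nil ->
    (forall u c, unsplitable u -> (forall x, (mu x < mu (split u c))%N -> P x) ->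
      P (split u c)) -> forall a, P a.
  move=> P0 Ps a; have [n] := ubnP (mu a); elim: n a => // n IH a an.
  have [->//|/eqP a0] := eqVneq a pf_nil.
  have [uu ea] := facP _ a0; rewrite ea; apply: Ps => // x; rewrite -ea => xa.
  by apply: IH; lia.
have MsplitE u c : M K (split u c) = M K u * M K c - low u c.
  by rewrite /low opprB addrC subrK.
have decomp (y : PFSym K) : y = \sum_(c <- msupp y) y@_c *: M K c.
  by rewrite -[LHS]linext_id.
(* On the basis, the remainder [low u c] cancels against the correction built into [h]. *)
have mulU u y : unsplitable u -> linext h (M K u * y) = f (M K u) * linext h y.
  move=> uu; rewrite {1}(decomp y) mulr_sumr linear_sum [in RHS]/linext mulr_sumr.
  apply: eq_bigr => c _; rewrite /= -scalerAr linearZ /= -scalerAr; congr (_ *: _).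
  have -> : M K u * M K c = M K (split u c) + low u c by rewrite MsplitE subrK.
  by rewrite linearD /= linextM splitP // subrK.
(* Induction covers both [c], which is shorter, and the terms of [low u c]; associativity reduces
   the product with [M K u] to [mulU]. *)
have mulL a y : linext h (M K a * y) = h a * linext h y.
  elim/ind: a => [|u c uu IH]; first by rewrite -one_PFSym mul1r h1 mul1r.
  rewrite MsplitE mulrBl -mulrA linearB /= mulU // IH ?mu_fac // splitP //.
  rewrite [in RHS]mulrBl mulrA.
  congr (_ - _); have [L -> hL] := lowE u c.
  rewrite mulr_suml !linear_sum /= mulr_suml !big_seq; apply: eq_bigr => x xL.
  by rewrite IH ?hL // linextM.
have mono : monoid_morphism (linext h).
  split=> [|x y]; first by rewrite one_PFSym linextM.
  rewrite {1}(decomp x) mulr_suml linear_sum [linext h x]/linext mulr_suml.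
  by apply: eq_bigr => a _; rewrite /= -scalerAl linearZ /= mulL scalerAl.
pose g : {lrmorphism PFSym K -> A} := HB.pack (linext h : PFSym K -> A)
  (GRing.isLinear.Build K _ A _ (linext h) (linext_is_linear h))
  (GRing.isMonoidMorphism.Build _ _ (linext h) mono).
exists g; split=> [_ [a ua ->]|g' g'f x].
  (* Here [a] is factored with cofactor [pf_nil], and the remainder vanishes because [M K pf_nil] is
     the unit. *)
  rewrite /= linextM -(split_nil_r a) splitP // h1 mulr1 split_nil_r.
  by rewrite /low -one_PFSym mulr1 split_nil_r subrr linear0 subr0.
(* Any morphism extending [f] satisfies the recursion that determines [h]. *)
have g'h a : g' (M K a) = h a.
  elim/ind: a => [|u c uu IH]; first by rewrite -one_PFSym rmorph1 h1.
  rewrite MsplitE rmorphB rmorphM /= splitP // g'f; last by exists u.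
  rewrite IH ?mu_fac //; congr (_ - _); have [L -> hL] := lowE u c.
  by rewrite !linear_sum /= !big_seq; apply: eq_bigr => x0 xL; rewrite linextM IH ?hL.
rewrite {1}(decomp x) linear_sum /=; apply: eq_bigr => a _.
by rewrite linearZ /= g'h.
Qed.
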